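(* Let $\varepsilon=\varepsilon(n)\in(0,1/2)$ satisfy $1/\varepsilon = n^{o(1)}$ (i.e. $\log(1/\varepsilon)=o(\log n)$ as $n\to\infty$). For every constant $C>0$ there exist constants $c>0$ and $n_0$ such that for every $n\ge n_0$ that is a power of $2$ the following holds: if an algorithm ${\mathcal A}=(M^{(0)},\dots,M^{(m)})$ in the linear algebraic model described in the context computes $\operatorname{Id}_n+\varepsilon F_n$ and is $(1+C\varepsilon)$-well conditioned, then $$ m \;\ge\; c\,\frac{n\log n}{\log(1/\varepsilon)}. $$
   Context: For $n=2^k$, $F_n$ is the (normalized) $n\times n$ Walsh–Hadamard matrix, $F_n(i,j)=n^{-1/2}(-1)^{\langle i-1,j-1\rangle}$, where $\langle a,b\rangle$ is the dot product (over the integers) of the base-$2$ digit vectors of the integers $a,b$; it is symmetric and orthogonal. $\operatorname{Id}_n+\varepsilon F_n$ is called a Fourier $\varepsilon$-perturbation. For $i\ne i'$ and an angle $\Theta$, $R_{i,i',\Theta}\in\mathbb R^{n\times n}$ is the matrix with $R(i,i)=R(i',i')=\cos\Theta$, $R(i,i')=\sin\Theta$, $R(i',i)=-\sin\Theta$, all other diagonal entries $1$ and all other entries $0$. An algorithm with $m$ steps is a sequence of real $n\times n$ matrices ${\mathcal A}=(M^{(0)}=\operatorname{Id}_n,M^{(1)},\dots,M^{(m)})$ where for each $t\in[m]$ either (constant gate) $M^{(t)}$ is obtained from $M^{(t-1)}$ by multiplying one row by a nonzero real constant, or (rotation) $M^{(t)}=R_{i_t,i'_t,\Theta_t}M^{(t-1)}$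 for some rows $i_t\neq i'_t$ and angle $\Theta_t$. ${\mathcal A}$ computes $X$ if $M^{(m)}=X$. The condition number $\kappa(M)$ of a nonsingular matrix is the ratio of its largest to smallest singular value; ${\mathcal A}$ is $\kappa$-well conditioned if $\kappa(M^{(t)})\le\kappa$ for all $t\in[m]$. Logarithms are base $2$. *)

(* Defs.v *)
From HB Require Import structures.
From mathcomp Require Import all_boot all_order all_algebra.
From mathcomp Require Import all_classical all_reals all_analysis.
Set Implicit Arguments. Unset Strict Implicit. Unset Printing Implicit Defensive.
Import Order.TTheory GRing.Theory Num.Theory.
Local Open Scope ring_scope.

Section Defs.
Variable R : realType.

Definition log2 (x : R) : R := ln x / ln 2.

Definition bitdot (k a b : nat) : nat :=
  \sum_(l < k) (odd (a %/ 2 ^ l) * odd (b %/ 2 ^ l))%N.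

(* Normalized Walsh–Hadamard matrix F_n, n = 2^k, with 0-based indices
   (entry (i,j) here is entry (i+1,j+1) of the paper). *)
Definition hadamard (k : nat) : 'M[R]_(2 ^ k) :=
  \matrix_(i, j) ((Num.sqrt (2 ^ k)%:R)^-1 * (-1) ^+ bitdot k i j).

Definition rotmx (n : nat) (i i' : 'I_n) (th : R) : 'M[R]_n :=
  \matrix_(a, b)
    (if (a == i) && (b == i) then cos th
     else if (a == i') && (b == i') then cos th
     else if (a == i) && (b == i') then sin th
     else if (a == i') && (b == i) then - sin th
     else if a == b then 1 else 0).

Definition scale_row (n : nat) (i : 'I_n) (c : R) (M : 'M[R]_n) : 'M[R]_n :=
  \matrix_(a, b) (if a == i then c * M a b else M a b).

Definition alg_step (n : nat) (A B : 'M[R]_n) : Prop :=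
  (exists (i : 'I_n) (c : R), c != 0 /\ B = scale_row i c A) \/
  (exists (i i' : 'I_n) (th : R), i != i' /\ B = rotmx i i' th *m A).

Definition is_algorithm (n : nat) (m : nat) (M : nat -> 'M[R]_n) : Prop :=
  M 0%N = 1%:M /\ forall t, (0 < t <= m)%N -> alg_step (M t.-1) (M t).

Definition computes (n : nat) (m : nat) (M : nat -> 'M[R]_n) (X : 'M[R]_n) :=
  M m = X.

Definition singular_value (n : nat) (M : 'M[R]_n) (s : R) : Prop :=
  0 <= s /\ eigenvalue (M^T *m M) (s ^+ 2).

(* kappa(M) <= kap : M nonsingular and (largest singular value) /
   (smallest singular value) <= kap, i.e. every singular value is at most
   kap times every singular value. *)
Definition cond_le (n : nat) (M : 'M[R]_n) (kap : R) : Prop :=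
  M \in unitmx /\
  forall s1 s2, singular_value M s1 -> singular_value M s2 -> s1 <= kap * s2.

Definition well_conditioned (n : nat) (m : nat) (M : nat -> 'M[R]_n) (kap : R) :=
  forall t, (0 < t <= m)%N -> cond_le (M t) kap.

End Defs.

(* Main.v *)
Require Import Defs.
From HB Require Import structures.
From mathcomp Require Import all_boot all_order all_algebra.
From mathcomp Require Import all_classical all_reals all_analysis.
From mathcomp Require Import zify ring lra.
Import Order.TTheory GRing.Theory Num.Theory.
Local Open Scope ring_scope.
Set Implicit Arguments. Unset Strict Implicit. Unset Printing Implicit Defensive.

(** Let [h z = z * ln |z|], and for a nonsingular [M] put
      [Phi M = \sum_(i, j) (h ((M F)_ij (M^-T)_ij) - h ((M^-T F)_ij M_ij))].
    Constant gates multiply a row of [M] by [c] and the same row of [M^-T] by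
    [c^-1], so they leave [Phi] unchanged.  A rotation acts simultaneously on
    two rows of [M] and of [M^-T].  The sum of the arguments of [h] over these
    two rows is invariant in each column, so by [h (N z) = N h z + N z ln N]
    the arguments may be normalized by the rotation-invariant column weight
    [N].  As [M] is [(1 + C eps)]-well conditioned, for some [lam > 0] the
    rows of [M / lam] and [lam M^-T] are bounded and differ by [O(eps)] in
    norm; hence the two arguments of [h] are close and, [h] having modulus of
    continuity [(1 + ln (1/eps)) |u - v| + 2 eps] on [[-1, 1]], a rotation
    changes [Phi] by [O(eps ln (1/eps))] only.  Finally [Phi Id = 0], while at
    [Id + eps F] the off-diagonal entries contribute about [2 eps n ln n] and
    the diagonal ones only [O(eps n ln (1/eps)) = o(eps n ln n)]. *)

(** * Quadratic forms and extremal eigenvalues of symmetric matrices *)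

Definition dot (R : realType) (n : nat) (u v : 'rV[R]_n) : R := (u *m v^T) 0 0.

Section Dot.
Context {R : realType} {n : nat}.
Implicit Types (u v x : 'rV[R]_n) (A T : 'M[R]_n).

Lemma dotE u v : dot u v = \sum_j u 0 j * v 0 j.
Proof. by rewrite /dot mxE; apply: eq_bigr => j _; rewrite mxE. Qed.

Lemma dotC u v : dot u v = dot v u.
Proof. by rewrite !dotE; apply: eq_bigr => j _; rewrite mulrC. Qed.

Lemma dotDl u v x : dot (u + v) x = dot u x + dot v x.
Proof. by rewrite /dot mulmxDl mxE. Qed.

Lemma dotZl a u v : dot (a *: u) v = a * dot u v.
Proof. by rewrite /dot -scalemxAl mxE. Qed.

Lemma dotDr u v x : dot x (u + v) = dot x u + dot x v.
Proof. by rewrite dotC dotDl !(dotC x). Qed.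

Lemma dotZr a u v : dot u (a *: v) = a * dot u v.
Proof. by rewrite dotC dotZl dotC. Qed.

Lemma dot_mull u v A : dot (u *m A) v = dot u (v *m A^T).
Proof. by rewrite /dot trmx_mul trmxK mulmxA. Qed.

Lemma dot_ge0 u : 0 <= dot u u.
Proof. by rewrite dotE; apply: sumr_ge0 => j _; rewrite -expr2 sqr_ge0. Qed.

Lemma dot_eq0 u : (dot u u == 0) = (u == 0).
Proof.
apply/idP/eqP => [|->]; last by rewrite /dot mul0mx mxE.
rewrite dotE psumr_eq0; last by move=> j _; rewrite -expr2 sqr_ge0.
move/allP => h; apply/rowP => j; rewrite mxE.
by have := h j (mem_index_enum j); rewrite -expr2 sqrf_eq0 => /eqP.
Qed.

(** Each product of two coordinates of [x] is at most the mean of their squares, hence at most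
    [dot x x]. The summand 1 makes [b] positive, so that it can be divided by later. *)
Lemma form_bounded T : exists2 b : R, 0 < b & forall x, dot (x *m T) x <= b * dot x x.
Proof.
exists (1 + \sum_j \sum_i `|T i j|) => [|x].
  by rewrite ltr_wpDr // sumr_ge0 // => i _; apply: sumr_ge0.
have sq i : `|x 0 i| ^+ 2 <= dot x x.
  rewrite real_normK ?num_real // dotE (bigD1 i) //= -expr2 lerDl sumr_ge0 // => j _.
  by rewrite -expr2 sqr_ge0.
apply: (@le_trans _ _ ((\sum_j \sum_i `|T i j|) * dot x x)); last first.
  by rewrite ler_wpM2r ?dot_ge0 // lerDr.
rewrite mulr_suml [dot (_ *m _) _]dotE; apply: ler_sum => j _.
rewrite mxE !mulr_suml; apply: ler_sum => i _.
apply: le_trans (ler_norm _) _; rewrite !normrM mulrAC mulrC ler_wpM2l //.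
by have := sq i; have := sq j; have := sqr_ge0 (`|x 0 i| - `|x 0 j|); rewrite sqrrB; lra.
Qed.

(* Expand the form at [x - t^-1 *: (x *m T)]. *)
Lemma psd_sqr_le T t x : T^T = T -> 0 < t ->
  (forall y, 0 <= dot (y *m T) y) -> (forall y, dot (y *m T) y <= t * dot y y) ->
  dot (x *m T) (x *m T) <= t * dot (x *m T) x.
Proof.
move=> sT t0 psd bd; set y := x *m T.
have := psd (x + (- t^-1) *: y); rewrite mulmxDl -scalemxAl -/y !(dotDl, dotDr, dotZl, dotZr).
rewrite (dot_mull y x) sT -/y.
have := bd y; set a := dot y x; set b := dot y y; set c := dot _ y => bc.
have t0' : 0 < t^-1 by rewrite invr_gt0.
have : t^-1 * c <= b by rewrite mulrC ler_pdivrMr // mulrC.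
rewrite -(ler_pM2l t0') => h1 h2.
have : 0 <= a - t^-1 * b by lra.
rewrite subr_ge0 mulrC ler_pdivrMr // mulrC //.
Qed.

(* The eigenvalue is the largest [a] with [T - a%:M] positive semidefinite: if that
   matrix were invertible, it would still be positive definite with a margin. *)
Lemma extremal_eigenvalue T : (0 < n)%N -> T^T = T ->
  exists2 a : R, eigenvalue T a & forall x, a * dot x x <= dot (x *m T) x.
Proof.
move=> n0 sT.
pose E := [set a : R | forall x, a * dot x x <= dot (x *m T) x]%classic.
have E0 : nonempty E.
  have [b b0 hb] := form_bounded (- T); exists (- b) => x /=.
  by have := hb x; rewrite mulmxN -scaleN1r dotZl; lra.
have supE : has_sup E.
  split => //; pose e : 'rV[R]_n := delta_mx 0 (Ordinal n0).
  have e0 : 0 < dot e e.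
    rewrite lt_def dot_ge0 dot_eq0 andbT; apply/eqP => /rowP /(_ (Ordinal n0)).
    by rewrite !mxE !eqxx => /eqP; rewrite oner_eq0.
  exists (dot (e *m T) e / dot e e) => a /(_ e).
  by rewrite ler_pdivlMr.
have aE x : sup E * dot x x <= dot (x *m T) x.
  have [/eqP x0|x0] := boolP (dot x x == 0).
    by rewrite x0 mulr0; move/eqP: x0; rewrite dot_eq0 => /eqP ->; rewrite mul0mx /dot mul0mx mxE.
  have x1 : 0 < dot x x by rewrite lt_def x0 dot_ge0.
  rewrite -ler_pdivlMr //; apply: ge_sup => // a /(_ x).
  by rewrite ler_pdivlMr.
exists (sup E) => //; apply: contraT => /negPn/eqP ker0; rewrite /eigenspace in ker0.
set T' := T - (sup E)%:M in ker0.
have T'u : T' \in unitmx by rewrite -row_free_unit -kermx_eq0 ker0.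
have sT' : T'^T = T' by rewrite /T' linearB /= sT tr_scalar_mx.
have T'E x : dot (x *m T') x = dot (x *m T) x - sup E * dot x x.
  by rewrite /T' mulmxBr mul_mx_scalar -scaleNr dotDl dotZl mulNr.
have psd x : 0 <= dot (x *m T') x by rewrite T'E subr_ge0.
have [t t0 ht] := form_bounded T'.
have [b b0 hb] := form_bounded (invmx T' *m (invmx T')^T).
(* The margin: [hb] at [x *m T'] bounds [dot x x] by [b] times the squared norm of [x *m T'], and
   [psd_sqr_le] bounds that norm by [t] times the form of [T'] at [x]. *)
have : sup E + (b * t)^-1 <= sup E.
  apply: ub_le_sup; first by case: supE.
  move=> x /=; rewrite mulrDl -lerBrDl -T'E mulrC ler_pdivrMr ?mulr_gt0 //.
  have := psd_sqr_le x sT' t0 psd ht.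
  rewrite -(ler_pM2l b0) => h; apply: le_trans (le_trans _ h) _; last first.
    by rewrite mulrA mulrC.
  have := hb (x *m T'); rewrite mulmxA mulmxK // dot_mull trmxK.
  by rewrite dot_mull mulmxK.
by rewrite gerDl leNgt invr_gt0 mulr_gt0.
Qed.

End Dot.

(** * Modulus of continuity of [z * ln |z|] *)

Definition xlogx (R : realType) (z : R) : R := z * ln `|z|.

Section Xlogx.
Context {R : realType}.
Implicit Types e u v N p q : R.

(** This is [ln (1 + x) <= x] at [x = v / u - 1], multiplied by [u]. *)
Lemma ln_ratio_le u v : 0 < u -> 0 < v -> u * (ln v - ln u) <= v - u.
Proof.
move=> u0 v0; have vu : 0 < v / u by rewrite divr_gt0.
have := @le_ln1Dx R (v / u - 1); rewrite (_ : 1 + (v / u - 1) = v / u); last by ring.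
rewrite ln_div ?posrE // => h.
have {h}/(ler_wpM2l (ltW u0)) : ln v - ln u <= v / u - 1 by apply: h; lra.
by rewrite [u * (v / u - 1)]mulrBr mulrCA divff ?lt0r_neq0 // !mulr1.
Qed.

(* Clipping the logarithm at [e] makes [xlogx] Lipschitz on [[-1, 1]], at the
   cost of an error [e]. *)
Lemma xlogx_clip e u : 0 < e -> `|xlogx u - u * ln (Num.max `|u| e)| <= e.
Proof.
move=> e0; rewrite /xlogx; case: (leP e `|u|) => ue.
  by rewrite subrr normr0 ltW.
have [->|u0] := eqVneq u 0; first by rewrite !mul0r subrr normr0 ltW.
have u1 : 0 < `|u| by rewrite normr_gt0.
rewrite -mulrBr normrM distrC (@ger0_norm _ (ln e - _)) ?subr_ge0 ?ler_ln ?posrE ?(ltW ue) //.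
by have := ln_ratio_le u1 e0; lra.
Qed.

Lemma clip_modulus e u v : 0 < e -> e <= 1 -> `|u| <= 1 -> `|v| <= `|u| ->
  `|u * ln (Num.max `|u| e) - v * ln (Num.max `|v| e)| <= (1 - ln e) * `|u - v|.
Proof.
move=> e0 e1 u1 vu; set a := Num.max `|u| e; set b := Num.max `|v| e.
have ae : e <= a by rewrite /a le_max lexx orbT.
have be : e <= b by rewrite /b le_max lexx orbT.
have a1 : a <= 1 by rewrite /a ge_max u1.
have vb : `|v| <= b by rewrite /b le_max lexx.
have ba : b <= a by rewrite /a /b ge_max !le_max vu lexx orbT.
have a0 : 0 < a by lra.
have b0 : 0 < b by lra.
have abuv : a - b <= `|u - v|.
  have := lerB_dist u v; rewrite /a /b; case: (leP e `|u|); case: (leP e `|v|) => //; lra.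
have lnea : ln e <= ln a by rewrite ler_ln.
have lna : ln a <= 0 by rewrite ln_le0.
have lnba : ln b <= ln a by rewrite ler_ln.
(* The first term costs at most [- ln e] times [|u - v|]. As [|v| <= b], the second is at most
   [b * (ln a - ln b) <= a - b], and clipping does not increase distances. *)
have -> : u * ln a - v * ln b = (u - v) * ln a + v * (ln a - ln b) by ring.
apply: le_trans (ler_normD _ _) _; rewrite !normrM (ler0_norm lna).
rewrite (@ger0_norm _ (ln a - ln b)) ?subr_ge0 //.
have h1 : `|v| * (ln a - ln b) <= b * (ln a - ln b) by rewrite ler_wpM2r // subr_ge0.
have h2 := ln_ratio_le b0 a0.
have h3 : `|u - v| * - ln a <= `|u - v| * - ln e by rewrite ler_wpM2l //; lra.
lra.
Qed.

Lemma xlogx_modulus1 e u v : 0 < e -> e <= 1 -> `|u| <= 1 -> `|v| <= 1 ->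
  `|xlogx u - xlogx v| <= (1 - ln e) * `|u - v| + 2 * e.
Proof.
move=> e0 e1; wlog vu : u v / `|v| <= `|u|.
  move=> W u1 v1; case: (leP `|v| `|u|) => h; first exact: W.
  by rewrite distrC (distrC u); apply: W => //; exact: ltW.
move=> u1 _; have := clip_modulus e0 e1 u1 vu.
have := xlogx_clip u e0; have := xlogx_clip v e0.
rewrite !ler_norml => /andP[? ?] /andP[? ?] /andP[? ?].
by apply/andP; split; lra.
Qed.

Lemma xlogx_scale N u : 0 < N -> xlogx (N * u) = N * xlogx u + N * u * ln N.
Proof.
move=> N0; rewrite /xlogx normrM (gtr0_norm N0).
have [->|u0] := eqVneq u 0; first by rewrite !(mul0r, mulr0) addr0.
by rewrite lnM ?posrE ?normr_gt0 //; ring.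
Qed.

(** Division by [N] brings [p] and [q] into [[-1, 1]]. The price is the term [(p - q) * ln N], kept
    explicit because it will cancel between the two sides of a rotation. *)
Lemma xlogx_modulus e N p q : 0 < e -> e <= 1 -> `|p| <= N -> `|q| <= N ->
  `|xlogx p - xlogx q - (p - q) * ln N| <= (1 - ln e) * `|p - q| + 2 * e * N.
Proof.
move=> e0 e1 pN qN; have N0 : 0 <= N by exact: le_trans pN.
have [N00|N00] := eqVneq N 0.
  move: pN qN; rewrite N00 !normr_le0 => /eqP -> /eqP ->.
  by rewrite !subrr !mul0r subr0 normr0 !mulr0 addr0.
have {N00}N0 : 0 < N by rewrite lt_def N00.
have E x : x = N * (x / N) by rewrite mulrCA divff ?mulr1 // lt0r_neq0.
move: pN qN; rewrite (E p) (E q); move: (p / N) (q / N) => a b.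
rewrite !normrM (gtr0_norm N0) !ger_pMr // => a1 b1; rewrite !xlogx_scale //.
rewrite (_ : _ - _ - _ = N * (xlogx a - xlogx b)); last by ring.
rewrite -mulrBr !normrM (gtr0_norm N0).
by have := ler_wpM2l (ltW N0) (xlogx_modulus1 e0 e1 a1 b1); lra.
Qed.

End Xlogx.

(** * Row bounds from the condition number *)

Section Conditioning.
Context {R : realType} {n : nat}.
Implicit Types (M X Y : 'M[R]_n) (kap e s lam : R).

Lemma dot_mulgram M (x : 'rV[R]_n) :
  dot (x *m (M^T *m M)) x = dot (x *m M^T) (x *m M^T).
Proof. by rewrite mulmxA dot_mull. Qed.

Lemma eigenvalue_gram_ge0 M a : eigenvalue (M^T *m M) a -> 0 <= a.
Proof.
case/eigenvalueP => v va v0; have : 0 <= dot (v *m (M^T *m M)) v.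
  by rewrite dot_mulgram dot_ge0.
by rewrite va dotZl pmulr_lge0 // lt_def dot_ge0 dot_eq0 v0.
Qed.

(** Here [lam] is the least singular value. The extremal eigenvalues of [P] and [- P] bound the form
    of [P] from below and above; both come from singular values of [M], which [kap] compares. *)
Lemma cond_le_form M kap : (0 < n)%N -> 0 <= kap -> cond_le M kap ->
  exists2 lam : R, 0 < lam & forall x : 'rV[R]_n,
    lam ^+ 2 * dot x x <= dot (x *m (M^T *m M)) x <= (kap * lam) ^+ 2 * dot x x.
Proof.
move=> n0 kap0 [Mu Mk]; set P := M^T *m M.
have sP : P^T = P by rewrite /P trmx_mul trmxK.
have [a ea ha] := extremal_eigenvalue n0 sP.
have [|b eb hb] := @extremal_eigenvalue _ _ (- P) n0; first by rewrite linearN /= sP.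
have {}eb : eigenvalue P (- b).
  case/eigenvalueP: eb => v vb v0; apply/eigenvalueP; exists v => //.
  by rewrite scaleNr -vb mulmxN opprK.
have a0 := eigenvalue_gram_ge0 ea; have b0 := eigenvalue_gram_ge0 eb.
have Pu : P \in unitmx by rewrite unitmx_mul unitmx_tr Mu.
have a1 : 0 < a.
  rewrite lt_def a0 andbT; apply/eqP => az; case/eigenvalueP: ea => v.
  by rewrite az scale0r => /(congr1 (mulmx^~ (invmx P))); rewrite mulmxK // mul0mx => -> /eqP.
exists (Num.sqrt a) => [|x]; first by rewrite sqrtr_gt0.
rewrite sqr_sqrtr // ha /=.
have := Mk (Num.sqrt (- b)) (Num.sqrt a).
rewrite /singular_value !sqrtr_ge0 !sqr_sqrtr // => /(_ (conj isT eb) (conj isT ea)) h.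
have hb' : dot (x *m P) x <= - b * dot x x.
  by have := hb x; rewrite mulmxN -scaleN1r dotZl; lra.
apply: (le_trans hb'); rewrite ler_wpM2r ?dot_ge0 // -[leLHS]sqr_sqrtr //.
by rewrite lerXn2r // nnegrE ?mulr_ge0 ?sqrtr_ge0.
Qed.

Definition row_sqr (A : 'M[R]_n) i := \sum_j A i j ^+ 2.

Lemma row_sqrE A i : row_sqr A i = dot (row i A) (row i A).
Proof. by rewrite dotE; apply: eq_bigr => j _; rewrite !mxE expr2. Qed.

(** With [y] the row of the inverse transpose, the row of [M] is [y *m P] and that of [X - Y] is
    [lam^-1 *: (y *m (P - (lam ^+ 2)%:M))]. The forms of these two matrices lie between 0 and
    [lam ^+ 2 * t], with [t] equal to [kap ^+ 2] and [kap ^+ 2 - 1], so [psd_sqr_le] bounds both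
    rows. *)
Lemma cond_le_rows M kap : (0 < n)%N -> 1 < kap -> cond_le M kap ->
  exists2 lam : R, 0 < lam & forall i,
    let X := lam^-1 *: M in let Y := lam *: (invmx M)^T in
    [/\ row_sqr X i <= kap ^+ 4, row_sqr Y i <= 1 &
        row_sqr (X - Y) i <= (kap ^+ 2 - 1) ^+ 2].
Proof.
move=> n0 k1 Mk; have k0 : 0 <= kap by lra.
have [lam lam0 hP] := cond_le_form n0 k0 Mk; case: Mk => Mu _.
exists lam => // i X Y; rewrite !row_sqrE.
set P := M^T *m M in hP; have sP : P^T = P by rewrite /P trmx_mul trmxK.
pose y := row i (invmx M)^T.
have yP : y *m P = row i M.
  by rewrite /P mulmxA -!row_mul -trmx_mul mulmxV // trmx1 mul1mx.
have l2 : 0 < lam ^+ 2 by rewrite exprn_gt0.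
(* The form of [P] at [y] is the squared norm of a row of the identity. *)
have y1 : lam ^+ 2 * dot y y <= 1.
  have /andP[+ _] := hP y; rewrite dot_mulgram.
  rewrite -!row_mul -trmx_mul mulmxV // trmx1 => h; apply: le_trans h _.
  rewrite -row_sqrE /row_sqr (bigD1 i) //= big1 => [|j ji]; rewrite !mxE ?eqxx.
    by rewrite addr0 expr1n.
  by rewrite eq_sym (negPf ji) expr0n.
have k2 : 1 < kap ^+ 2 by rewrite exprn_egt1.
have bound T t : T^T = T -> 0 < t -> (forall x, 0 <= dot (x *m T) x) ->
    (forall x, dot (x *m T) x <= lam ^+ 2 * t * dot x x) ->
    lam^-1 ^+ 2 * dot (y *m T) (y *m T) <= t ^+ 2.
  move=> sT t0 psd hT; have lt0 : 0 < lam ^+ 2 * t by rewrite mulr_gt0.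
  rewrite exprVn ler_pdivrMl //.
  apply: le_trans (psd_sqr_le y sT lt0 psd hT) _.
  have h1 := ler_wpM2l (ltW lt0) (hT y).
  apply: le_trans h1 _.
  rewrite (_ : (lam ^+ 2 * t) * (lam ^+ 2 * t * dot y y)
    = (lam ^+ 2 * t ^+ 2) * (lam ^+ 2 * dot y y)); last by ring.
  by rewrite ler_piMr // mulr_ge0 ?ltW // exprn_gt0.
have rowZ c (A : 'M[R]_n) : row i (c *: A) = c *: row i A by rewrite linearZ.
split.
- rewrite rowZ dotZl dotZr mulrA -expr2 -yP (_ : kap ^+ 4 = (kap ^+ 2) ^+ 2); last by ring.
  apply: bound => [//||x|x]; first by lra.
    by rewrite dot_mulgram dot_ge0.
  by have /andP[_] := hP x; rewrite exprMn mulrC (mulrC (lam ^+ 2)) mulrC.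
- by rewrite rowZ dotZl dotZr mulrA -expr2.
- have -> : row i (X - Y) = lam^-1 *: (y *m (P - (lam ^+ 2)%:M)).
    rewrite mulmxBr yP mul_mx_scalar scalerBr scalerA expr2 mulKf ?lt0r_neq0 //.
    by rewrite linearB /= !rowZ.
  rewrite dotZl dotZr mulrA -expr2.
  have E x : dot (x *m (P - (lam ^+ 2)%:M)) x = dot (x *m P) x - lam ^+ 2 * dot x x.
    by rewrite mulmxBr mul_mx_scalar -scaleNr dotDl dotZl mulNr.
  apply: bound => [||x|x].
  + by rewrite linearB /= sP tr_scalar_mx.
  + by lra.
  + by rewrite E subr_ge0; case/andP: (hP x).
  + rewrite E mulrBr mulr1 mulrBl lerB // -exprMn mulrC (mulrC lam) mulrC.
    by case/andP: (hP x).
Qed.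

End Conditioning.

(** * The potential and its change under gates *)

Section Potential.
Context {R : realType} {n : nat}.
Implicit Types (F A B M X Y : 'M[R]_n) (e S lam th c : R) (i j r : 'I_n).

(** The difference of the two arguments of [xlogx] in [gap]: the coefficient of [ln N] when these
    are normalized by a weight [N]. *)
Definition gap_lin F X Y r j := (X *m F) r j * Y r j - (Y *m F) r j * X r j.

Definition gap F X Y r j :=
  xlogx ((X *m F) r j * Y r j) - xlogx ((Y *m F) r j * X r j).

(* In the applications, [X] is the current matrix and [Y] its inverse transpose. *)
Definition potential F X Y := \sum_r \sum_j gap F X Y r j.

Definition pair_sqr A i i' j := A i j ^+ 2 + A i' j ^+ 2.

Lemma sum_pair_sqr A i i' : \sum_j pair_sqr A i i' j = row_sqr A i + row_sqr A i'.
Proof. by rewrite /pair_sqr big_split. Qed.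

Lemma row_sqr_orth F A i : F *m F^T = 1%:M -> row_sqr (A *m F) i = row_sqr A i.
Proof. by move=> FF; rewrite !row_sqrE row_mul dot_mull -mulmxA FF mulmx1. Qed.

(* [x y - a b = (x - a) y + (y - b) a], and Young's inequality with weight [e] on each product. *)
Lemma mul_diff_le e (x y a b : R) : 0 < e ->
  `|x * y - a * b| <= (e * (y ^+ 2 + a ^+ 2) + e^-1 * ((x - a) ^+ 2 + (y - b) ^+ 2)) / 2.
Proof.
move=> e0; have young (u v : R) : `|u * v| <= (e * v ^+ 2 + e^-1 * u ^+ 2) / 2.
  have ei : 0 < e^-1 by rewrite invr_gt0.
  have ee : e^-1 * e = 1 by rewrite mulVf ?lt0r_neq0.
  have h w : 0 <= e^-1 * (e * v - w * u) ^+ 2 by rewrite mulr_ge0 ?sqr_ge0 ?ltW.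
  have E w : e^-1 * (e * v - w * u) ^+ 2
      = (e^-1 * e) * (e * v ^+ 2) - 2 * w * (e^-1 * e) * (u * v) + e^-1 * (w ^+ 2 * u ^+ 2).
    by ring.
  have := h 1; have := h (-1); rewrite !E ee => h1 h2.
  by rewrite ler_norml; apply/andP; split; lra.
have := young (x - a) y; have := young (y - b) a.
have -> : x * y - a * b = (x - a) * y + (y - b) * a by ring.
move=> h1 h2; apply: le_trans (ler_normD _ _) _; lra.
Qed.

(** The normalizing weight [N] of a column: it dominates all four arguments of [xlogx] in the two
    rows, and a rotation of these rows preserves it. *)
Definition pair_weight F X Y i i' j :=
  pair_sqr (X *m F) i i' j + pair_sqr Y i i' j + pair_sqr (Y *m F) i i' j + pair_sqr X i i' j.

(** [xlogx_modulus] is applied in each column with its own weight. Young's weight is [e] because the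
    rows of [X - Y] have squared norm of order [e ^+ 2], which makes both halves of [G] of order
    [e]. Orthogonality of [F] lets rows of [X *m F] and [Y *m F] be measured by those of [X] and
    [Y]. *)
Lemma pair_gap_le F X Y i i' e S :
    F *m F^T = 1%:M -> 0 < e -> e <= 1 ->
    \sum_j pair_sqr X i i' j <= S -> \sum_j pair_sqr Y i i' j <= S ->
    \sum_j pair_sqr (X - Y) i i' j <= S * e ^+ 2 ->
  `|\sum_j (gap F X Y i j + gap F X Y i' j
      - (gap_lin F X Y i j + gap_lin F X Y i' j) * ln (pair_weight F X Y i i' j))|
  <= 18 * S * (e * (1 - ln e)).
Proof.
move=> FF e0 e1 hX hY hD; have L0 : ln e <= 0 by rewrite ln_le0.
pose G j := (e * (pair_sqr Y i i' j + pair_sqr (Y *m F) i i' j)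
   + e^-1 * (pair_sqr ((X - Y) *m F) i i' j + pair_sqr (X - Y) i i' j)) / 2.
have sq0 A r j : 0 <= A r j ^+ 2 by apply: sqr_ge0.
have ptw j : `|gap F X Y i j + gap F X Y i' j
      - (gap_lin F X Y i j + gap_lin F X Y i' j) * ln (pair_weight F X Y i i' j)|
    <= (1 - ln e) * G j + 4 * e * pair_weight F X Y i i' j.
  set N := pair_weight _ _ _ _ _ _.
  have mN (u v : R) : u ^+ 2 + v ^+ 2 <= N -> `|u * v| <= N.
    move=> uv; rewrite ler_norml; have := sqr_ge0 (u + v); have := sqr_ge0 (u - v).
    have := sqr_ge0 u; have := sqr_ge0 v; rewrite sqrrB sqrrD.
    by move=> ? ? ? ?; apply/andP; split; lra.
  have row r : r = i \/ r = i' ->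
      `|gap F X Y r j - gap_lin F X Y r j * ln N|
        <= (1 - ln e) * `|gap_lin F X Y r j| + 2 * e * N.
    move=> hr; apply: xlogx_modulus => //; apply: mN; rewrite /N /pair_weight /pair_sqr;
    have := (sq0 (X *m F) i j, sq0 (X *m F) i' j, sq0 (Y *m F) i j, sq0 (Y *m F) i' j,
      sq0 X i j, sq0 X i' j, sq0 Y i j, sq0 Y i' j) => -[[[[[[[? ?] ?] ?] ?] ?] ?] ?];
    by case: hr => ->; lra.
  have hi := row i (or_introl erefl); have hi' := row i' (or_intror erefl).
  have glin r : `|gap_lin F X Y r j| <= (e * (Y r j ^+ 2 + (Y *m F) r j ^+ 2)
     + e^-1 * (((X - Y) *m F) r j ^+ 2 + (X - Y) r j ^+ 2)) / 2.
    apply: le_trans (mul_diff_le _ _ _ _ e0) _.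
    by rewrite mulmxBl !mxE (_ : (Y r j - X r j) ^+ 2 = (X r j - Y r j) ^+ 2) //; ring.
  have gG : `|gap_lin F X Y i j| + `|gap_lin F X Y i' j| <= G j.
    by have := glin i; have := glin i'; rewrite /G /pair_sqr; lra.
  have {gG}gG : (1 - ln e) * (`|gap_lin F X Y i j| + `|gap_lin F X Y i' j|) <= (1 - ln e) * G j.
    by rewrite ler_wpM2l //; lra.
  rewrite (_ : _ - _ = (gap F X Y i j - gap_lin F X Y i j * ln N)
     + (gap F X Y i' j - gap_lin F X Y i' j * ln N)); last by ring.
  by apply: le_trans (ler_normD _ _) _; lra.
apply: le_trans (ler_norm_sum _ _ _) _.
apply: le_trans (ler_sum _ (fun j _ => ptw j)) _.
rewrite /G big_split /= -!mulr_sumr -mulr_suml big_split /= -!mulr_sumr /pair_weight !big_split /=.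
rewrite -!/(row_sqr _ _) !row_sqr_orth //; rewrite !sum_pair_sqr in hX hY hD.
have ei : e^-1 * (2 * (row_sqr (X - Y) i + row_sqr (X - Y) i')) <= 2 * S * e.
  by rewrite ler_pdivrMl //; have := hD; rewrite expr2; lra.
have hYe : e * (row_sqr Y i + row_sqr Y i') <= e * S by rewrite ler_wpM2l // ltW.
have hXe : e * (row_sqr X i + row_sqr X i') <= e * S by rewrite ler_wpM2l // ltW.
have S0 : 0 <= S.
  by apply: le_trans hX; rewrite addr_ge0 //; apply: sumr_ge0.
have eS : 0 <= e * S by rewrite mulr_ge0 // ltW.
have LS : 0 <= - ln e * (e * S) by rewrite mulr_ge0 // oppr_ge0.
set y := row_sqr Y i + row_sqr Y i' in hYe *.
set d := row_sqr (X - Y) i + row_sqr (X - Y) i' in ei *.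
(* The sum of [G] is at most [2 * S * e]. The weights sum to at most [4 * S] and carry the factor
   [4 * e], which gives the remaining 16 of the constant 18. *)
have hG : (1 - ln e) * ((e * (y + y) + e^-1 * (d + d)) / 2) <= (1 - ln e) * (2 * (e * S)).
  by clear FF; rewrite ler_wpM2l //; lra.
by lra.
Qed.

Section Rotation.
Context {i i' : 'I_n} (ii' : i != i') (th : R).
Let Q := rotmx i i' th.

Let i'i : (i' == i) = false. Proof. by rewrite eq_sym (negPf ii'). Qed.

Lemma rot_row1 A j : (Q *m A) i j = cos th * A i j + sin th * A i' j.
Proof.
rewrite mxE (bigD1 i) //= (bigD1 i') ?i'i //= big1 ?addr0.
  by rewrite !mxE !eqxx (negPf ii') i'i.
move=> l /andP[li li']; rewrite !mxE eqxx (negPf li) (negPf li') (negPf ii') /=.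
by rewrite eq_sym (negPf li) mul0r.
Qed.

Lemma rot_row2 A j : (Q *m A) i' j = - sin th * A i j + cos th * A i' j.
Proof.
rewrite mxE (bigD1 i) //= (bigD1 i') ?i'i //= big1 ?addr0.
  by rewrite !mxE !eqxx i'i (negPf ii').
move=> l /andP[li li']; rewrite !mxE eqxx (negPf li) (negPf li') i'i /=.
by rewrite eq_sym (negPf li') mul0r.
Qed.

Lemma rot_row A r j : r != i -> r != i' -> (Q *m A) r j = A r j.
Proof.
move=> ri ri'; rewrite mxE (bigD1 r) //= big1 ?addr0.
  by rewrite !mxE !eqxx (negPf ri) (negPf ri') mul1r.
by move=> l lr; rewrite !mxE (negPf ri) (negPf ri') /= eq_sym (negPf lr) mul0r.
Qed.

Lemma rot_pair_sqr A j : pair_sqr (Q *m A) i i' j = pair_sqr A i i' j.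
Proof.
rewrite /pair_sqr rot_row1 rot_row2.
have -> : forall c s a b : R, (c * a + s * b) ^+ 2 + (- s * a + c * b) ^+ 2
   = (c ^+ 2 + s ^+ 2) * (a ^+ 2 + b ^+ 2) by move=> *; ring.
by rewrite cos2Dsin2 mul1r.
Qed.

(** In a fixed column, the products summed over the two rows form an inner product of plane vectors,
    both turned by the same angle. *)
Lemma rot_gap_lin F X Y j :
  gap_lin F (Q *m X) (Q *m Y) i j + gap_lin F (Q *m X) (Q *m Y) i' j
  = gap_lin F X Y i j + gap_lin F X Y i' j.
Proof.
rewrite /gap_lin -!mulmxA !(rot_row1, rot_row2).
rewrite -[RHS]mul1r -(cos2Dsin2 th); ring.
Qed.

(** The logarithmic terms subtracted in [pair_gap_le] agree before and after the rotation, so only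
    the two errors remain. Two rows double [S], whence [2 * 18 * 2 = 72]. *)
Lemma rot_potential_le F X Y e S :
    F *m F^T = 1%:M -> 0 < e -> e <= 1 ->
    (forall r, row_sqr X r <= S) -> (forall r, row_sqr Y r <= S) ->
    (forall r, row_sqr (X - Y) r <= S * e ^+ 2) ->
  `|potential F (Q *m X) (Q *m Y) - potential F X Y| <= 72 * S * (e * (1 - ln e)).
Proof.
move=> FF e0 e1 hX hY hD.
have pX : \sum_j pair_sqr X i i' j <= 2 * S.
  by rewrite sum_pair_sqr; have := hX i; have := hX i'; lra.
have pY : \sum_j pair_sqr Y i i' j <= 2 * S.
  by rewrite sum_pair_sqr; have := hY i; have := hY i'; lra.
have pD : \sum_j pair_sqr (X - Y) i i' j <= (2 * S) * e ^+ 2.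
  by rewrite sum_pair_sqr; have := hD i; have := hD i'; lra.
have rotS A : \sum_j pair_sqr (Q *m A) i i' j = \sum_j pair_sqr A i i' j.
  by apply: eq_bigr => j _; rewrite rot_pair_sqr.
have before := pair_gap_le FF e0 e1 pX pY pD.
have after := @pair_gap_le F (Q *m X) (Q *m Y) i i' e (2 * S) FF e0 e1.
rewrite -mulmxBr !rotS in after; have {}after := after pX pY pD.
have same j : (gap_lin F (Q *m X) (Q *m Y) i j + gap_lin F (Q *m X) (Q *m Y) i' j)
    * ln (pair_weight F (Q *m X) (Q *m Y) i i' j)
  = (gap_lin F X Y i j + gap_lin F X Y i' j) * ln (pair_weight F X Y i i' j).
  by rewrite rot_gap_lin /pair_weight -!mulmxA !rot_pair_sqr.
rewrite (eq_bigr _ (fun j _ => congr1 (+%R _) (congr1 -%R (same j)))) in after.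
have potE X' Y' : potential F X' Y' = \sum_j gap F X' Y' i j + \sum_j gap F X' Y' i' j
    + \sum_(r | (r != i) && (r != i')) \sum_j gap F X' Y' r j.
  by rewrite /potential (bigD1 i) //= [X in _ + X](bigD1 i') ?i'i //= addrA.
have lin (a b c : 'I_n -> R) : \sum_j (a j + b j - c j) = \sum_j a j + \sum_j b j - \sum_j c j.
  by rewrite sumrB big_split.
have rest : \sum_(r | (r != i) && (r != i')) \sum_j gap F (Q *m X) (Q *m Y) r j
   = \sum_(r | (r != i) && (r != i')) \sum_j gap F X Y r j.
  apply: eq_bigr => r /andP[ri ri']; apply: eq_bigr => j _.
  by rewrite /gap -!mulmxA !rot_row.
rewrite !potE rest; rewrite !lin in before after.
move: before after; rewrite !ler_norml.
by move=> /andP[? ?] /andP[? ?]; apply/andP; split; lra.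
Qed.

End Rotation.

Lemma scale_rowE i c A : scale_row i c A = diag_mx (\row_j (if j == i then c else 1)) *m A.
Proof.
by apply/matrixP => a b; rewrite mul_diag_mx !mxE; case: eqP => // _; rewrite mul1r.
Qed.

Lemma scale_row_potential F X Y i c : c != 0 ->
  potential F (scale_row i c X) (scale_row i c^-1 Y) = potential F X Y.
Proof.
move=> c0; apply: eq_bigr => r _; apply: eq_bigr => j _; rewrite /gap.
have S A d : (scale_row i d A *m F) r j = (if r == i then d else 1) * (A *m F) r j.
  by rewrite scale_rowE -mulmxA mul_diag_mx !mxE.
rewrite !S !mxE; case: eqP => // _; last by rewrite !mul1r.
by congr (xlogx _ - xlogx _); rewrite mulrACA ?mulfV ?mulVf // mul1r.
Qed.

(** This makes the normalization by the [lam] of [cond_le_rows] free of charge. *)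
Lemma scale_potential F X Y lam : lam != 0 ->
  potential F (lam^-1 *: X) (lam *: Y) = potential F X Y.
Proof.
move=> l0; apply: eq_bigr => r _; apply: eq_bigr => j _; rewrite /gap -!scalemxAl !mxE.
by congr (xlogx _ - xlogx _); rewrite mulrACA ?mulfV ?mulVf // mul1r.
Qed.

End Potential.

(** * Orthogonality of the Walsh-Hadamard matrix *)

Lemma bitdotC k a b : bitdot k a b = bitdot k b a.
Proof. by apply: eq_bigr => l _; rewrite mulnC. Qed.

Lemma bitdotS k a b : bitdot k.+1 a b = (odd a * odd b + bitdot k a./2 b./2)%N.
Proof.
rewrite /bitdot big_ord_recl !divn1; congr (_ + _)%N.
by apply: eq_bigr => l _; rewrite lift0 expnS !divnMA !divn2.
Qed.

Lemma sum_even_odd (R : realType) n (f : nat -> R) :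
  \sum_(0 <= j < n.*2) f j = \sum_(0 <= j < n) (f j.*2 + f j.*2.+1).
Proof.
elim: n => [|n IH]; first by rewrite !big_nil.
by rewrite doubleS !big_nat_recr //= IH addrA.
Qed.

Section Hadamard.
Context {R : realType}.

(** Induction on the number of bits: pairing [j.*2] with [j.*2.+1] splits off a factor that is 2
    when [a] and [b] have the same lowest bit and 0 otherwise. *)
Lemma walsh_orthogonal k a b : (a < 2 ^ k)%N -> (b < 2 ^ k)%N ->
  \sum_(0 <= j < 2 ^ k) (-1) ^+ bitdot k a j * (-1) ^+ bitdot k b j
    = (2 ^ k)%:R * (a == b)%:R :> R.
Proof.
elim: k a b => [|k IH] a b.
  rewrite !ltnS !leqn0 => /eqP -> /eqP ->.
  by rewrite big_nat1 /bitdot !big_ord0 !expr0 !mul1r.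
rewrite expnS mul2n => ha hb; rewrite sum_even_odd.
have half (c d : nat) : (c < d.*2)%N -> (c./2 < d)%N by rewrite -divn2 ltn_divLR // muln2.
have E j : (-1) ^+ bitdot k.+1 a j.*2 * (-1) ^+ bitdot k.+1 b j.*2
    + (-1) ^+ bitdot k.+1 a j.*2.+1 * (-1) ^+ bitdot k.+1 b j.*2.+1
  = (1 + (-1) ^+ odd a * (-1) ^+ odd b)
    * ((-1) ^+ bitdot k a./2 j * (-1) ^+ bitdot k b./2 j) :> R.
  rewrite !bitdotS /= !uphalf_double !doubleK odd_double /= !muln0 !muln1 !add0n !exprD.
  by ring.
rewrite (eq_bigr _ (fun j _ => E j)).
rewrite -mulr_sumr IH ?half // -[in RHS](odd_double_half a) -[in RHS](odd_double_half b).
rewrite -mul2n natrM.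
case: (odd a) (odd b) => [] [] /=; rewrite ?expr0 ?expr1 ?mulN1r ?opprK ?mulr1 ?mul1r.
- by rewrite eqn_add2l (inj_eq double_inj); ring.
- rewrite addrN mul0r add1n add0n; case: eqP => [/(congr1 odd)|]; last by rewrite mulr0.
  by rewrite /= !odd_double.
- rewrite addrN mul0r add1n add0n; case: eqP => [/(congr1 odd)|]; last by rewrite mulr0.
  by rewrite /= !odd_double.
- by rewrite !add0n (inj_eq double_inj); ring.
Qed.

Lemma hadamard_sym k : (hadamard R k)^T = hadamard R k.
Proof. by apply/matrixP => i j; rewrite !mxE bitdotC. Qed.

Lemma hadamard_sqr_entry k i j : hadamard R k i j ^+ 2 = (2 ^ k)%:R^-1.
Proof. by rewrite mxE exprMn sqrr_sign mulr1 exprVn sqr_sqrtr. Qed.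

Lemma hadamard_invol k : hadamard R k *m hadamard R k = 1%:M.
Proof.
apply/matrixP => i j; rewrite mxE.
have n0 : ((2 ^ k)%:R : R) != 0 by rewrite pnatr_eq0 expn_eq0.
under eq_bigr => l _ do rewrite !mxE (bitdotC k l) mulrACA -expr2 exprVn sqr_sqrtr //.
rewrite -mulr_sumr -(big_mkord xpredT (fun l => (-1) ^+ bitdot k i l * (-1) ^+ bitdot k j l)).
by rewrite walsh_orthogonal // mulrA mulVf // mul1r mxE.
Qed.

End Hadamard.

(** * Lower bound for the potential of the Fourier perturbation *)

Section TargetPotential.
Context {R : realType} {n : nat}.
Implicit Types (F : 'M[R]_n) (e : R).

(** Since [F] is an involution, [(1 + e F) (1 - e F) = 1 - e ^ 2]. *)
Lemma invmx_perturbed F e (g := (1 - e ^+ 2)^-1) :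
    F^T = F -> F *m F = 1%:M -> e ^+ 2 < 1 ->
  (invmx (1%:M + e *: F))^T = g *: (1%:M - e *: F).
Proof.
move=> symF FF e2; have gden : g * (1 - e ^+ 2) = 1.
  by rewrite mulVf // lt0r_neq0 // subr_gt0.
have h : (1%:M + e *: F) *m (g *: (1%:M - e *: F)) = 1%:M.
  rewrite -scalemxAr mulmxDl mul1mx mulmxBr mulmx1 -scalemxAl -scalemxAr FF scalerA.
  by rewrite addrA subrK -expr2 -{1}[1%:M]scale1r -scalerBl scalerA gden scale1r.
have [u _] := mulmx1_unit h.
have -> : invmx (1%:M + e *: F) = g *: (1%:M - e *: F).
  by apply: (can_inj (mulKmx u)); rewrite mulmxV // h.
rewrite linearZ linearB /= linearZ /= trmx1.
by rewrite symF.
Qed.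

Lemma target_potential F e :
    F^T = F -> F *m F = 1%:M -> (forall i j, F i j ^+ 2 = n%:R^-1) ->
    0 < e -> e < 2^-1 -> (64 <= n)%N ->
  e * n%:R * (ln n%:R - 5 * (1 - ln e))
    <= potential F (1%:M + e *: F) (invmx (1%:M + e *: F))^T.
Proof.
move=> symF FF F2 e0 e2 n64; pose g := (1 - e ^+ 2)^-1.
have e2lt : e ^+ 2 < e / 2 by rewrite expr2 ltr_pM2l.
have den_gt0 : 0 < 1 - e ^+ 2 by lra.
 have n64R : 64 <= n%:R :> R by rewrite (ler_nat R 64).
have n0 : 0 < n%:R :> R by lra.
have ni0 : 0 < n%:R^-1 :> R by rewrite invr_gt0.
have ni64 : n%:R^-1 <= 64^-1 :> R by rewrite lef_pV2 ?posrE.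
have nni : n%:R * n%:R^-1 = 1 :> R by rewrite mulfV ?lt0r_neq0.
have g0 : 0 < g by rewrite invr_gt0.
have g1 : 1 <= g by rewrite invf_ge1 // gerBl sqr_ge0.
have g43 : g <= 4 / 3.
  by rewrite -[leRHS]invf_div lef_pV2 ?posrE //; lra.
have ln0 : 0 <= ln n%:R :> R by rewrite ln_ge0 //; lra.
have le0 : ln e <= 0 by rewrite ln_le0 //; lra.
rewrite invmx_perturbed //; last by lra.
rewrite -/g.
have MF : (1%:M + e *: F) *m F = F + e%:M.
  by rewrite mulmxDl mul1mx -scalemxAl FF scale_scalar_mx mulr1.
have YF : (g *: (1%:M - e *: F)) *m F = g *: (F - e%:M).
  by rewrite -scalemxAl mulmxBl mul1mx -scalemxAl FF scale_scalar_mx mulr1.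
(* Off the diagonal the two arguments are [- t] and [t] with [t = g * e / n], so the logarithms add
   up instead of cancelling: the gap is [- 2 * t * ln t], and [e / n <= t <= 1 / n]. *)
have off i j : i != j -> 2 * (e / n%:R) * ln n%:R
    <= gap F (1%:M + e *: F) (g *: (1%:M - e *: F)) i j.
  move=> ij; rewrite /gap MF YF !mxE (negPf ij) /= !(mulr0n, addr0, add0r, subr0, sub0r).
  have -> : F i j * (g * - (e * F i j)) = - (g * (e * F i j ^+ 2)) by ring.
  have -> : g * F i j * (e * F i j) = g * (e * F i j ^+ 2) by ring.
  rewrite F2; set t := g * _.
  have en0 : 0 < e / n%:R by rewrite mulr_gt0.
  have t0 : 0 < t by rewrite mulr_gt0.
  have te : e / n%:R <= t by rewrite ler_peMl // ltW.
  have tn : t <= n%:R^-1.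
    rewrite /t mulrA ler_piMl // ?ltW //.
    by have := ler_wpM2r (ltW e0) g43; lra.
  have lnt : ln n%:R <= - ln t.
    by rewrite lerNr -lnV ?posrE // ler_ln ?posrE.
  rewrite /xlogx normrN (gtr0_norm t0).
  have h1 : e / n%:R * ln n%:R <= t * ln n%:R by rewrite ler_wpM2r.
  have h2 : t * ln n%:R <= t * - ln t by rewrite ler_wpM2l // ltW.
  lra.
have diag i : - (5 * e * (1 - ln e))
    <= gap F (1%:M + e *: F) (g *: (1%:M - e *: F)) i i.
  rewrite /gap MF YF !mxE eqxx /= !mulr1n.
  have := F2 i i; set f := F i i => f2.
  (* The bound [64 <= n] enters here; it keeps [p] and [q] in [[-1, 1]], as [xlogx_modulus1]
     demands. *)
  have f8 : `|f| <= 8^-1.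
    rewrite -(@ler_pXn2r _ 2) ?nnegrE // real_normK ?num_real // f2.
    by apply: le_trans ni64 _; lra.
  have /andP[fl fu] : - 8^-1 <= f <= 8^-1 by rewrite -ler_norml.
  have /andP[efl efu] : - 16^-1 <= e * f <= 16^-1.
    rewrite -ler_norml normrM (gtr0_norm e0).
    apply: le_trans (ler_wpM2r (normr_ge0 f) (ltW e2)) _; lra.
  have b1 (x y : R) : - (5 / 8) <= x <= 5 / 8 -> 0 <= y <= 17 / 16 -> `|x * (g * y)| <= 1.
    move=> hx /andP[y0 y1]; rewrite !normrM (gtr0_norm g0) (ger0_norm y0).
    have hxn : `|x| <= 5 / 8 by rewrite ler_norml.
    have gy : g * y <= 4 / 3 * (17 / 16) by apply: ler_pM => //; exact: ltW.
    have gy0 : 0 <= g * y by rewrite mulr_ge0 // ltW.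
    by have := ler_pM (normr_ge0 x) gy0 hxn gy; lra.
  set p := (f + e) * _; set q := g * _ * _.
  have p1 : `|p| <= 1 by apply: b1; apply/andP; split; lra.
  have q1 : `|q| <= 1.
    rewrite (_ : q = (f - e) * (g * (1 + e * f))); last by rewrite /q; ring.
    by apply: b1; apply/andP; split; lra.
  have pq : `|p - q| <= 3 * e.
    rewrite (_ : p - q = 2 * (g * e) - 2 * (g * e * f ^+ 2)); last by rewrite /p /q; ring.
    have ge0 : 0 <= g * e by rewrite mulr_ge0 ?ltW.
    have ge43 : g * e <= 4 / 3 * e by rewrite ler_wpM2r // ltW.
    have gef0 : 0 <= g * e * f ^+ 2 by rewrite mulr_ge0 // sqr_ge0.
    have gef1 : g * e * f ^+ 2 <= g * e * 1 by rewrite ler_wpM2l // f2; lra.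
    by rewrite ler_norml; apply/andP; split; lra.
  have e1 : e <= 1 by lra.
  have := xlogx_modulus1 e0 e1 p1 q1.
  have lpq : (1 - ln e) * `|p - q| <= (1 - ln e) * (3 * e)
    by rewrite ler_wpM2l //; lra.
  have le : 0 <= e * - ln e by rewrite mulr_ge0 ?oppr_ge0 // ltW.
  by rewrite ler_norml => /andP[h _]; lra.
have row i : e * (ln n%:R - 5 * (1 - ln e))
    <= \sum_j gap F (1%:M + e *: F) (g *: (1%:M - e *: F)) i j.
  rewrite (bigD1 i) //=; apply: le_trans (lerD (diag i) (ler_sum _ _)); last first.
    by move=> j ji; apply: off; rewrite eq_sym.
  rewrite sumr_const (cardC1 i) card_ord -[X in _ <= _ + X]mulr_natl.
  have -> : n.-1%:R = n%:R - 1 :> R by rewrite -subn1 natrB //; lia.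
  have el : 0 <= e * ln n%:R by rewrite mulr_ge0 // ltW.
  have nel : n%:R^-1 * (e * ln n%:R) <= 64^-1 * (e * ln n%:R) by rewrite ler_wpM2r.
  (* The off-diagonal total is [2 * (1 - 1 / n) * e * ln n]; giving up the factor 2 absorbs the
     [1 / n]. *)
  have -> : (n%:R - 1) * (2 * (e / n%:R) * ln n%:R)
     = 2 * (n%:R * n%:R^-1) * (e * ln n%:R) - 2 * (n%:R^-1 * (e * ln n%:R)) by ring.
  by rewrite nni; lra.
apply: le_trans (ler_sum _ (fun i _ => row i)).
by rewrite sumr_const card_ord -[leRHS]mulr_natl; lra.
Qed.

End TargetPotential.

(** * Change of the potential in one step of an algorithm *)

Section Step.
Context {R : realType} {n : nat}.
Implicit Types (F A B M X Y : 'M[R]_n).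

Lemma invmx_tr_eq M Y : M *m Y^T = 1%:M -> (invmx M)^T = Y.
Proof.
move=> h; have [u _] := mulmx1_unit h.
have -> : invmx M = Y^T by apply: (can_inj (mulKmx u)); rewrite mulmxV // h.
by rewrite trmxK.
Qed.

Lemma rotmx_orth (i i' : 'I_n) (th : R) : i != i' ->
  rotmx i i' th *m (rotmx i i' th)^T = 1%:M.
Proof.
move=> ii'; have i'i : (i' == i) = false by rewrite eq_sym (negPf ii').
have c2 := cos2Dsin2 th.
apply/matrixP => a b; have [->|ai] := eqVneq a i.
  rewrite rot_row1 // !mxE; have [->|bi] := eqVneq b i.
    by rewrite !eqxx (negPf ii') i'i /= -!expr2 c2.
  have [_|_] := eqVneq b i'; rewrite !eqxx i'i ?(negPf ii') /=.
    by rewrite mulrN mulrC addNr.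
  by rewrite !mulr0 addr0.
have [->|ai'] := eqVneq a i'.
  rewrite rot_row2 // !mxE; have [->|bi] := eqVneq b i.
    by rewrite !eqxx i'i (negPf ii') /= mulNr mulrC addNr.
  have [_|_] := eqVneq b i'; rewrite !eqxx i'i ?(negPf ii') /=.
    by rewrite mulrNN -!expr2 addrC c2.
  by rewrite !mulr0 addr0.
by rewrite rot_row // !mxE (negPf ai) (negPf ai') !andbF /= eq_sym; case: eqP.
Qed.

Lemma scale_row_inv A i (c : R) : A \in unitmx -> c != 0 ->
  (invmx (scale_row i c A))^T = scale_row i c^-1 (invmx A)^T.
Proof.
move=> Au c0; apply: invmx_tr_eq.
rewrite !scale_rowE trmx_mul trmxK mulmxA mulmxK // tr_diag_mx.
apply/matrixP => a b; rewrite mul_diag_mx !mxE.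
case: (eqVneq a b) => _; rewrite ?mulr1n ?mulr0n ?mulr0 //.
by case: eqP => _; rewrite ?mulfV // mul1r.
Qed.

Lemma rot_inv A i i' (th : R) : A \in unitmx -> i != i' ->
  (invmx (rotmx i i' th *m A))^T = rotmx i i' th *m (invmx A)^T.
Proof.
move=> Au ii'; apply: invmx_tr_eq.
by rewrite trmx_mul trmxK mulmxA mulmxK // rotmx_orth.
Qed.

(** Orthogonal matrices are those equal to their inverse transpose; this asks for it up to a scalar
    [lam] and an error of order [e] in each row. *)
Definition near_orthogonal (S e : R) M := exists2 lam : R, 0 < lam & forall i,
  let X := lam^-1 *: M in let Y := lam *: (invmx M)^T in
  [/\ row_sqr X i <= S, row_sqr Y i <= S & row_sqr (X - Y) i <= S * e ^+ 2].

Lemma near_orthogonal1 (S e : R) : 1 <= S -> near_orthogonal S e 1%:M.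
Proof.
move=> S1; exists 1 => // i /=; rewrite invr1 !scale1r invmx1 trmx1 subrr.
have -> : row_sqr (0 : 'M[R]_n) i = 0.
  by rewrite /row_sqr big1 // => j _; rewrite mxE expr0n.
have -> : row_sqr (1%:M : 'M[R]_n) i = 1.
  rewrite /row_sqr (bigD1 i) //= big1 => [|j ji]; rewrite !mxE ?eqxx.
    by rewrite addr0 expr1n.
  by rewrite eq_sym (negPf ji) expr0n.
by split=> //; rewrite mulr_ge0 ?sqr_ge0 //; lra.
Qed.

(** The first summand of the constant covers [kap ^+ 4], the second the quotient of
    [(kap ^+ 2 - 1) ^+ 2] by [e ^+ 2], where [kap = 1 + C * e]. *)
Lemma cond_le_near_orthogonal M (C e : R) : (0 < n)%N -> 0 < C -> 0 < e -> e <= 1 ->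
  cond_le M (1 + C * e) -> near_orthogonal ((1 + C) ^+ 4 + (2 * C + C ^+ 2) ^+ 2) e M.
Proof.
move=> n0 C0 e0 e1 Mk; have Ce : 0 < C * e by rewrite mulr_gt0.
have CeC : C * e <= C by rewrite ler_piMr // ltW.
have [|lam lam0 h] := cond_le_rows n0 _ Mk; first by lra.
exists lam => // i X Y; have [hX hY hD] := h i.
have C1 : 1 <= (1 + C) ^+ 4 by rewrite exprn_ege1 //; lra.
have Cs : 0 <= (2 * C + C ^+ 2) ^+ 2 := sqr_ge0 _.
have kC : (1 + C * e) ^+ 4 <= (1 + C) ^+ 4 by rewrite lerXn2r ?nnegrE //; lra.
split; [by apply: (le_trans hX); lra|by apply: (le_trans hY); lra|].
apply: (le_trans hD).
have -> : (1 + C * e) ^+ 2 - 1 = (2 * C + C * (C * e)) * e by ring.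
rewrite exprMn ler_wpM2r ?sqr_ge0 //.
have h1 : C * (C * e) <= C ^+ 2 by rewrite expr2 ler_wpM2l // ltW.
have h2 : 0 < C * (C * e) by rewrite mulr_gt0.
have h3 : (2 * C + C * (C * e)) ^+ 2 <= (2 * C + C ^+ 2) ^+ 2.
  by rewrite lerXn2r ?nnegrE //; lra.
by lra.
Qed.

Lemma step_potential_le F A B (S e : R) :
    F *m F^T = 1%:M -> 0 < e -> e <= 1 -> 0 <= S -> A \in unitmx -> near_orthogonal S e A ->
    alg_step A B ->
  `|potential F B (invmx B)^T - potential F A (invmx A)^T| <= 72 * S * (e * (1 - ln e)).
Proof.
move=> FF e0 e1 S0 Au [lam lam0 h] [[i [c [c0 ->]]]|[i [i' [th [ii' ->]]]]].
  rewrite scale_row_inv // scale_row_potential // subrr normr0.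
  have L0 : ln e <= 0 by rewrite ln_le0.
  by rewrite !mulr_ge0 // ?(ltW e0) //; lra.
rewrite rot_inv //.
have l0 : lam != 0 by rewrite lt0r_neq0.
(* Both potentials are rescaled by the [lam] of [A], and the scalars are then moved past the
   rotation. *)
rewrite -(scale_potential _ _ _ l0) -[X in _ - X](scale_potential _ _ _ l0).
rewrite 2!scalemxAr.
by apply: rot_potential_le => // r; have [] := h r.
Qed.

Lemma potential1 F : potential F 1%:M (invmx 1%:M)^T = 0.
Proof.
rewrite invmx1 trmx1 /potential big1 // => i _; rewrite big1 // => j _.
by rewrite /gap subrr.
Qed.

End Step.

(** * Counting the steps *)

Theorem theorem4p1 (R : realType) (eps : nat -> R)
  (heps : forall n, 0 < eps n < 2^-1)
  (hsmall : forall d : R, 0 < d -> exists N : nat, forall n : nat, (N <= n)%N ->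
              ln ((eps n)^-1) <= d * ln (n%:R)) :
  forall C : R, 0 < C ->
  exists (c : R) (n0 : nat), 0 < c /\
    forall k : nat, (n0 <= 2 ^ k)%N ->
    forall (m : nat) (M : nat -> 'M[R]_(2 ^ k)),
      is_algorithm m M ->
      computes m M (1%:M + eps (2 ^ k)%N *: hadamard R k) ->
      well_conditioned m M (1 + C * eps (2 ^ k)%N) ->
      c * ((2 ^ k)%:R * log2 ((2 ^ k)%:R)) / log2 ((eps (2 ^ k)%N)^-1) <= m%:R.
Proof.
move=> C C0; set S := (1 + C) ^+ 4 + (2 * C + C ^+ 2) ^+ 2.
have C1 : 1 <= (1 + C) ^+ 4 by rewrite exprn_ege1 //; lra.
have S1 : 1 <= S by have := sqr_ge0 (2 * C + C ^+ 2); rewrite /S; lra.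
(* With [L = ln (1 / e) >= 1 / 2] one has [5 * (1 + L) <= 15 * L], so [L <= ln n / 30] leaves half
   of [ln n] in [target_potential]. *)
have [|N hN] := hsmall 30^-1; first by rewrite invr_gt0.
(* The 432 is [72 * 3 * 2]: 72 per rotation, 3 from [1 + L <= 3 * L], and 2 from the lost half of
   [ln n]. *)
exists (432 * S)^-1, (maxn N 64); split; first by rewrite invr_gt0; lra.
move=> k; rewrite geq_max => /andP[/hN hL n64] m M [M0 Mstep] Mm Mcond.
set n := (2 ^ k)%N in hL n64 M M0 Mstep Mm Mcond *.
set e := eps n in hL Mm Mcond *; set F := hadamard R k in Mm.
have /andP[e0 e2] : 0 < e < 2^-1 := heps n.
have e1 : e <= 1 by lra.
have n0 : (0 < n)%N by rewrite expn_gt0.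
have FF : F *m F^T = 1%:M by rewrite hadamard_sym hadamard_invol.
pose phi t := potential F (M t) (invmx (M t))^T.
(* Well-conditioning speaks of [t >= 1]; the identity at [t = 0] is treated apart. *)
have near t : (t <= m)%N -> M t \in unitmx /\ near_orthogonal S e (M t).
  case: t => [_|t tm]; first by rewrite M0 unitmx1; split=> //; exact: near_orthogonal1.
  by have Mt := Mcond t.+1 tm; split; [case: Mt|exact: cond_le_near_orthogonal].
have phi_le t : (t <= m)%N -> `|phi t| <= t%:R * (72 * S * (e * (1 - ln e))).
  elim: t => [_|t IH tm]; first by rewrite /phi M0 potential1 normr0 mul0r.
  have [Mu Mn] := near t (ltnW tm); have S0 : 0 <= S by lra.
  have := step_potential_le FF e0 e1 S0 Mu Mn (Mstep t.+1 tm).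
  rewrite -/(phi t) -/(phi t.+1) => h; rewrite -(subrK (phi t) (phi t.+1)).
  apply: le_trans (ler_normD _ _) _; rewrite -natr1 mulrDl mul1r addrC.
  by rewrite lerD // IH // ltnW.
have := target_potential (@hadamard_sym R k) (@hadamard_invol R k)
  (@hadamard_sqr_entry R k) e0 e2 n64.
rewrite -/F -/n => hT; have {hT} : e * n%:R * (ln n%:R - 5 * (1 - ln e)) <= phi m.
  by rewrite /phi Mm.
have := phi_le m (leqnn m); have := ler_norm (phi m).
move: hL; rewrite lnV ?posrE //; set L := - ln e => hL h1 h2 h3.
have LE : ln e = - L by rewrite opprK.
have ln2 : 2^-1 <= ln 2 :> R.
  by have := @ln_ratio_le R 2 1 (ltr0n _ 2) ltr01; rewrite ln1; lra.
have L2 : 2^-1 <= L.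
  by apply: (le_trans ln2); rewrite /L lerNr -lnV ?posrE // ler_ln ?posrE ?invr_gt0 // ltW.
have L0 : 0 < L by lra.
have nR : 0 < n%:R :> R by rewrite ltr0n.
have lower : e * (n%:R * (ln n%:R / 2)) <= phi m.
  apply: le_trans h3; rewrite -mulrA !ler_pM2l //; lra.
have upper : phi m <= e * (m%:R * (216 * S * L)).
  apply: (le_trans h1); apply: (le_trans h2).
  rewrite (_ : m%:R * (72 * S * (e * (1 - ln e)))
    = e * (m%:R * (72 * S * (1 - ln e)))); last by ring.
  by rewrite ler_pM2l // ler_wpM2l // (_ : 216 * S * L = 72 * S * (3 * L)) ?ler_wpM2l //; lra.
have key : n%:R * (ln n%:R / 2) <= m%:R * (216 * S * L).
  by rewrite -(ler_pM2l e0); exact: le_trans upper.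
have l2 : 0 < ln 2 :> R by lra.
(* The factors [ln 2] of the two base-2 logarithms cancel. *)
have -> : (432 * S)^-1 * (n%:R * log2 n%:R) / log2 e^-1 = n%:R * ln n%:R / (432 * S * L).
  rewrite /log2 lnV ?posrE // -/L; field.
  by rewrite !lt0r_neq0 //; lra.
rewrite ler_pdivrMr; first by lra.
by rewrite mulr_gt0 //; lra.
Qed.
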